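(* Let $\Phi=(G,\varphi)$ be a connected $\mathbb{T}$-gain graph and $<$ a total order on $V(G)$. The following are equivalent: (i) $\Phi$ is balanced; (ii) $D^{\max}_{<}(\Phi)$ has the same spectrum as $D(G)$; (iii) $D^{\min}_{<}(\Phi)$ has the same spectrum as $D(G)$; (iv) the largest eigenvalues of $D^{\max}_{<}(\Phi)$ and $D(G)$ are equal; (v) the largest eigenvalues of $D^{\min}_{<}(\Phi)$ and $D(G)$ are equal.
   Context: $\mathbb{T}=\{z\in\mathbb{C}:|z|=1\}$. A $\mathbb{T}$-gain graph $\Phi=(G,\varphi)$ on a simple graph $G$ with vertices $v_1,\dots,v_n$ assigns to each oriented edge $\overrightarrow{e}_{i,j}$ an element $\varphi(\overrightarrow{e}_{i,j})\in\mathbb{T}$ with $\varphi(\overrightarrow{e}_{j,i})=\varphi(\overrightarrow{e}_{i,j})^{-1}$. The gain of an oriented path or cycle is the product of the gains of its consecutive oriented edges; $\Phi$ is balanced if every cycle has gain $1$. $d(s,t)$ is the graph distance and $D(G)=(d(v_i,v_j))$ the distance matrix. $\mathcal{P}(s,t)$ is the set of oriented shortest paths from $s$ to $t$; $\mathcal{P}^{\max}(s,t)$ (resp. $\mathcal{P}^{\min}(s,t)$) is the set of those whose gain has maximum (resp. minimum) real part in $\mathcal{P}(s,t)$. For $s<t$, $\varphi^{<}_{\max}(s,t)$ is the gain of a path in $\mathcal{P}^{\max}(s,t)$ with maximum imaginary part of gain among paths in $\mathcal{P}^{\max}(s,t)$, and $\varphi^{<}_{\max}(t,s)=\overline{\varphi^{<}_{\max}(s,t)}$;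 $\varphi^{<}_{\min}(s,t)$ is the gain of a path in $\mathcal{P}^{\min}(s,t)$ with minimum imaginary part of gain among paths in $\mathcal{P}^{\min}(s,t)$, and $\varphi^{<}_{\min}(t,s)=\overline{\varphi^{<}_{\min}(s,t)}$. $D^{\max}_{<}(\Phi)=(\varphi^{<}_{\max}(v_i,v_j)d(v_i,v_j))$ and $D^{\min}_{<}(\Phi)=(\varphi^{<}_{\min}(v_i,v_j)d(v_i,v_j))$ (Hermitian matrices). *)

(* Defs.v *)
From HB Require Import structures.
From mathcomp Require Import all_boot all_order all_algebra.
From mathcomp Require Import reals.
From mathcomp Require Export complex.

Set Implicit Arguments.
Unset Strict Implicit.
Unset Printing Implicit Defensive.

Import Order.TTheory GRing.Theory Num.Theory.
Local Open Scope ring_scope.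
Local Open Scope complex_scope.

Record sgraph (n : nat) := SGraph {
  adj :> rel 'I_n;
  adj_sym : symmetric adj;
  adj_irr : irreflexive adj }.

(* Only the values of [gain] on adjacent pairs are meaningful. *)
Record gain_graph (R : realType) (n : nat) := GainGraph {
  ugraph : sgraph n;
  gain : 'I_n -> 'I_n -> R[i];
  gain_norm : forall u v, ugraph u v -> `|gain u v| = 1;
  gain_inv : forall u v, ugraph u v -> gain v u = (gain u v)^-1 }.

Definition strict_total_order (T : eqType) (lt : rel T) : Prop :=
  [/\ irreflexive lt, transitive lt &
      forall s t, s != t -> lt s t || lt t s].

Section Distance.
Variables (n : nat) (G : sgraph n).

Definition connected : Prop := (0 < n)%N /\ forall u v, connect G u v.

(* The sequence of vertices s :: p is a path of G from s to t. *)
Definition is_path (s t : 'I_n) (p : seq 'I_n) : bool :=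
  [&& path G s p, last s p == t & uniq (s :: p)].

(* Least length of a path from s to t (a path has fewer than n edges);
   the value is n when there is none. *)
Definition dist (s t : 'I_n) : nat :=
  find (fun k => [exists p : k.-tuple 'I_n, is_path s t p]) (iota 0 n).

Definition shortest_paths (s t : 'I_n) : {set (dist s t).-tuple 'I_n} :=
  [set p : (dist s t).-tuple 'I_n | is_path s t p].

End Distance.

Section Gain.
Variables (R : realType) (n : nat) (Phi : gain_graph R n).
Local Notation G := (ugraph Phi).

Fixpoint path_gain (s : 'I_n) (p : seq 'I_n) : R[i] :=
  if p is u :: q then gain Phi s u * path_gain u q else 1.

Definition cycle_gain (c : seq 'I_n) : R[i] :=
  if c is s :: p then path_gain s (rcons p s) else 1.

Definition balanced : Prop :=
  forall c : seq 'I_n, (2 < size c)%N -> ucycle G c -> cycle_gain c = 1.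

Definition max_paths (s t : 'I_n) : {set (dist G s t).-tuple 'I_n} :=
  [set p in shortest_paths G s t |
    [forall q in shortest_paths G s t,
      complex.Re (path_gain s q) <= complex.Re (path_gain s p)]].

Definition min_paths (s t : 'I_n) : {set (dist G s t).-tuple 'I_n} :=
  [set p in shortest_paths G s t |
    [forall q in shortest_paths G s t,
      complex.Re (path_gain s p) <= complex.Re (path_gain s q)]].

(* All the paths that [pick] may select have the same gain; the value 0 is
   only used when t cannot be reached from s. *)
Definition opt_max (s t : 'I_n) : R[i] :=
  if [pick p in max_paths s t | [forall q in max_paths s t,
        complex.Im (path_gain s q) <= complex.Im (path_gain s p)]] is Some p
  then path_gain s p else 0.

Definition opt_min (s t : 'I_n) : R[i] :=
  if [pick p in min_paths s t | [forall q in min_paths s t,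
        complex.Im (path_gain s p) <= complex.Im (path_gain s q)]] is Some p
  then path_gain s p else 0.

Variable lt : rel 'I_n.

(* On the diagonal the value is irrelevant since dist s s = 0. *)
Definition gain_max (s t : 'I_n) : R[i] :=
  if lt t s then (opt_max t s)^* else opt_max s t.

Definition gain_min (s t : 'I_n) : R[i] :=
  if lt t s then (opt_min t s)^* else opt_min s t.

Definition Dmax : 'M[R[i]]_n :=
  \matrix_(s, t) (gain_max s t * (dist G s t)%:R).

Definition Dmin : 'M[R[i]]_n :=
  \matrix_(s, t) (gain_min s t * (dist G s t)%:R).

End Gain.

Definition distmx (R : realType) (n : nat) (G : sgraph n) : 'M[R[i]]_n :=
  \matrix_(s, t) (dist G s t)%:R.

Section Spectrum.
Variables (R : realType) (n : nat).
Implicit Types A B : 'M[R[i]]_n.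

(* The eigenvalues of A, listed with their algebraic multiplicities. *)
Definition spectrum A : seq R[i] :=
  sval (closed_field_poly_normal (char_poly A)).

Definition same_spectrum A B : Prop := perm_eq (spectrum A) (spectrum B).

(* In R[i], x <= y means that y - x is a nonnegative real number. *)
Definition largest_eigenvalue A (l : R) : Prop :=
  eigenvalue A l%:C /\ forall x : R[i], eigenvalue A x -> x <= l%:C.

Definition same_largest_eigenvalue A B : Prop :=
  exists l : R, largest_eigenvalue A l /\ largest_eigenvalue B l.

End Spectrum.

(* Main.v *)
(** A connected gain graph is balanced iff its gain is a coboundary,
    [gain u v = theta u / theta v]. In that case every path from s to t has
    gain [theta s / theta t], so both gain distance matrices are conjugate to
    the distance matrix D by the diagonal matrix of theta. Conversely, let A be
    a gain distance matrix having the largest eigenvalue l of D as an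
    eigenvalue, with eigenvector x. The entries of A have the entries of D as
    moduli, so |x| reaches the maximum l of the Rayleigh quotient of D and is
    an eigenvector of D; as D is positive off the diagonal, x has no zero
    entry. Equality in the triangle inequality then gives
    [A s t = D s t * (theta s / theta t)] with [theta s = |x s| / x s], and on
    adjacent vertices A is the gain. *)
Require Import Defs.
From mathcomp Require Import all_boot all_order all_algebra.
From mathcomp Require Import reals zify ring.

Set Implicit Arguments.
Unset Strict Implicit.
Unset Printing Implicit Defensive.

Import Order.TTheory GRing.Theory Num.Theory.
Local Open Scope ring_scope.

Lemma last_rev_belast (T : Type) (x : T) (p : seq T) :
  last (last x p) (rev (belast x p)) = x.
Proof. by case: p => [//|y p] /=; rewrite rev_cons last_rcons. Qed.

Lemma rev_path_sym (T : Type) (e : rel T) (x : T) (p : seq T) :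
  symmetric e -> path e (last x p) (rev (belast x p)) = path e x p.
Proof.
by move=> e_sym; rewrite rev_path; apply: eq_path => y z; apply: e_sym.
Qed.

Lemma not_uniq_split (T : eqType) (s : seq T) :
  ~~ uniq s -> exists x a b c, s = a ++ x :: b ++ x :: c.
Proof.
elim: s => //= y s IHs; rewrite negb_and negbK => /orP[/splitPr[b c]|].
  by exists y, [::], b, c.
by case/IHs=> x [a [b [c ->]]]; exists x, (y :: a), b, c.
Qed.

Section LexicographicExtremum.
Variables (I : finType) (T : eqType) (ord : rel T).
Hypotheses (ord_refl : reflexive ord) (ord_trans : transitive ord).
Hypothesis ord_total : total ord.
Implicit Types (A : {set I}) (F : I -> T).

Definition extremal F A : {set I} :=
  [set i in A | [forall j in A, ord (F i) (F j)]].

Lemma extremal_neq0 F A : A != set0 -> extremal F A != set0.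
Proof.
case/set0Pn=> i0 Ai0; apply/set0Pn.
have [i Ai min_i] := extremumP F ord_refl ord_trans ord_total Ai0.
by exists i; rewrite inE; apply/andP; split=> //; apply/forall_inP.
Qed.

Lemma pick_lex_extremum F H A U (f : I -> U) (u : U) : A != set0 ->
  exists2 i, i \in A &
    (if [pick i in extremal F A |
           [forall j in extremal F A, ord (H i) (H j)]] is Some i
     then f i else u) = f i.
Proof.
move=> A_neq0; have /set0Pn[i0] := extremal_neq0 H (extremal_neq0 F A_neq0).
case: pickP => [i /andP[] | /(_ i0)]; last by rewrite !inE => ->.
by rewrite inE => /andP[Ai _] _ _; exists i.
Qed.

End LexicographicExtremum.

Section DistanceTheory.
Variables (n : nat) (G : sgraph n).
Implicit Types (s t : 'I_n) (p : seq 'I_n).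

Lemma is_path_rev s t p :
  is_path G s t p -> is_path G t s (rev (belast s p)).
Proof.
case/and3P=> Gp /eqP <- uniq_p; apply/and3P; split.
- by rewrite rev_path_sym //; apply: adj_sym.
- by rewrite last_rev_belast.
- by rewrite -rev_rcons -lastI rev_uniq.
Qed.

Lemma dist_sym s t : dist G s t = dist G t s.
Proof.
apply: eq_find => k; apply/existsP/existsP => -[p /is_path_rev Gp].
  by exists (rev_tuple (belast_tuple s p)).
by exists (rev_tuple (belast_tuple t p)).
Qed.

Lemma is_path_size_lt s t p : is_path G s t p -> (size p < n)%N.
Proof.
case/and3P=> _ _ /card_uniqP/= <-.
by rewrite -[leqRHS]card_ord max_card.
Qed.

Lemma dist_le_size s t p : is_path G s t p -> (dist G s t <= size p)%N.
Proof.
move=> Gp; rewrite leqNgt; apply/negP => /(before_find 0%N).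
rewrite nth_iota ?(is_path_size_lt Gp) // => /existsP[].
by exists (in_tuple p).
Qed.

Lemma shortest_paths_neq0 s t :
  (dist G s t < n)%N -> shortest_paths G s t != set0.
Proof.
move=> /[dup] dist_lt.
rewrite -[X in (_ < X)%N](size_iota 0) -has_find => /(nth_find 0%N).
rewrite nth_iota // => /existsP[p Gp]; apply/set0Pn.
by exists p; rewrite inE.
Qed.

Lemma connect_dist_lt s t : connect G s t -> (dist G s t < n)%N.
Proof.
case/connectP=> p0 /shortenP[p Gp uniq_p _] def_t.
have Gst : is_path G s t p by rewrite /is_path Gp def_t eqxx.
exact: leq_ltn_trans (dist_le_size Gst) (is_path_size_lt Gst).
Qed.

Lemma rev_shortest_path s t (p : (dist G s t).-tuple 'I_n) :
    p \in shortest_paths G s t ->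
  tcast (dist_sym s t) (rev_tuple (belast_tuple s p)) \in shortest_paths G t s.
Proof. by rewrite !inE val_tcast; apply: is_path_rev. Qed.

Lemma dist_gt0 s t : (0 < dist G s t)%N = (s != t).
Proof.
have n_gt0 : (0 < n)%N by apply: leq_ltn_trans (ltn_ord s).
have [<-|neq_st] := eqVneq s t.
  by apply/negbTE; rewrite -leqNgt (@dist_le_size s s [::]) // /is_path eqxx.
rewrite lt0n; apply: contraNneq neq_st => dist0.
have /set0Pn[p] : shortest_paths G s t != set0.
  by apply: shortest_paths_neq0; rewrite dist0.
have /size0nil p_nil : size p = 0%N by rewrite size_tuple.
by rewrite inE p_nil => /and3P[].
Qed.

Lemma dist_adj s t : G s t -> dist G s t = 1%N.
Proof.
move=> Gst; have neq_st : s != t.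
  by apply: contraTneq Gst => ->; rewrite adj_irr.
apply/eqP; rewrite eqn_leq dist_gt0 neq_st (@dist_le_size s t [:: t]) //.
by rewrite /is_path /= Gst eqxx inE neq_st.
Qed.

End DistanceTheory.

Section GainTheory.
Variables (R : realType) (n : nat) (Phi : gain_graph R n).
Local Notation G := (ugraph Phi).
Implicit Types (s t u v : 'I_n) (p q : seq 'I_n) (theta : 'I_n -> R[i]).

Lemma gain_neq0 u v : G u v -> gain Phi u v != 0.
Proof. by move=> Guv; rewrite -normr_eq0 gain_norm ?oner_neq0. Qed.

Lemma path_gain_cat s p q :
  path_gain Phi s (p ++ q) = path_gain Phi s p * path_gain Phi (last s p) q.
Proof. by elim: p s => [|u p IHp] s /=; rewrite ?mul1r // IHp mulrA. Qed.

Lemma path_gain_norm s p : path G s p -> `|path_gain Phi s p| = 1.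
Proof.
elim: p s => [|u p IHp] s /=; first by rewrite normr1.
by case/andP=> Gsu Gp; rewrite normrM gain_norm // IHp // mulr1.
Qed.

Lemma path_gain_neq0 s p : path G s p -> path_gain Phi s p != 0.
Proof. by move=> Gp; rewrite -normr_eq0 path_gain_norm ?oner_neq0. Qed.

Lemma path_gain_rev s p : path G s p ->
  path_gain Phi (last s p) (rev (belast s p)) = (path_gain Phi s p)^-1.
Proof.
elim: p s => [|u p IHp] s /=; first by rewrite invr1.
case/andP=> Gsu Gp; rewrite rev_cons -cats1 path_gain_cat IHp //.
by rewrite last_rev_belast /= mulr1 gain_inv // invfM mulrC.
Qed.

Lemma conjc_path_gain s p : path G s p ->
  conjc (path_gain Phi s p) = (path_gain Phi s p)^-1.
Proof.
by move=> /path_gain_norm norm_p; rewrite invC_norm norm_p expr1n invr1 mul1r.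
Qed.

Lemma balanced_ucycle_gain c :
  balanced Phi -> ucycle G c -> cycle_gain Phi c = 1.
Proof.
move=> bal; case: c => [|s [|u [|v c]]] //=; last exact: bal.
  by case/andP; rewrite /= adj_irr.
by case/andP=> /and3P[Gsu _ _] _; rewrite mulr1 (gain_inv Gsu) mulfV ?gain_neq0.
Qed.

(* A repeated vertex splits a closed walk into two shorter ones. *)
Lemma balanced_closed_walk_gain s p :
  balanced Phi -> path G s p -> last s p = s -> path_gain Phi s p = 1.
Proof.
move=> bal; have [m] := ubnP (size p); elim: m s p => // m IHm s p.
rewrite ltnS => le_pm Gp last_p.
have [uniq_p|/not_uniq_split[x [a [b [c def_p]]]]] := boolP (uniq p).
  case: (lastP p) Gp last_p uniq_p => [//|q u] Gq; rewrite last_rcons => def_u.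
  rewrite def_u in Gq * => uniq_q.
  apply: (balanced_ucycle_gain bal (c := s :: q)).
  by rewrite /ucycle /ucycleb /= Gq -rcons_uniq.
have [lt_b lt_ac] : (size (rcons b x) < m /\ size (a ++ x :: c) < m)%N.
  by move: le_pm; rewrite def_p !(size_cat, size_rcons) /= size_cat /=; lia.
move: Gp last_p; rewrite def_p cat_path /= cat_path last_cat /= last_cat /=.
case/and5P=> Ga Gax Gb Gbx Gc last_c.
have closed_b : path_gain Phi x (rcons b x) = 1.
  by apply: IHm; rewrite ?last_rcons // rcons_path Gb.
have <- : path_gain Phi s (a ++ x :: c) = 1.
  by apply: IHm; rewrite ?last_cat //= cat_path /= Ga Gax.
rewrite -cats1 path_gain_cat /= mulr1 in closed_b.
rewrite !path_gain_cat /= path_gain_cat /=.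
by rewrite [X in _ * (_ * X) = _]mulrA closed_b mul1r.
Qed.

Lemma balanced_path_gain s p q :
    balanced Phi -> path G s p -> path G s q -> last s p = last s q ->
  path_gain Phi s p = path_gain Phi s q.
Proof.
move=> bal Gp Gq last_pq; apply: (mulIf (invr_neq0 (path_gain_neq0 Gq))).
rewrite mulfV ?path_gain_neq0 // -path_gain_rev // -last_pq -path_gain_cat.
apply: balanced_closed_walk_gain => //.
  by rewrite cat_path Gp last_pq rev_path_sym //; apply: adj_sym.
by rewrite last_cat last_pq last_rev_belast.
Qed.

Definition potential theta : Prop :=
  (forall v, theta v != 0) /\
  (forall u v, G u v -> gain Phi u v = theta u / theta v).

Lemma potential_path_gain theta s p :
  potential theta -> path G s p ->
  path_gain Phi s p = theta s / theta (last s p).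
Proof.
case=> theta_neq0 thetaE; elim: p s => [|u p IHp] s /=.
  by rewrite divff.
by case/andP=> Gsu Gp; rewrite thetaE // IHp // mulrA divfK.
Qed.

Lemma potential_balanced theta : potential theta -> balanced Phi.
Proof.
move=> thetaP [|s p] // _ /andP[/= Gp _].
by rewrite (potential_path_gain thetaP Gp) last_rcons divff // thetaP.1.
Qed.

Lemma balanced_potential :
  connected G -> balanced Phi -> exists theta, potential theta.
Proof.
case=> n_gt0 Gc bal; pose root := Ordinal n_gt0.
have /fin_all_exists2[walk Gwalk last_walk] v :
    exists2 p, path G v p & last v p = root.
  by have /connectP[p Gp ->] := Gc v root; exists p.
exists (fun v => path_gain Phi v (walk v)); split=> [v|u v Guv].
  exact: path_gain_neq0.
apply: (mulIf (path_gain_neq0 (Gwalk v))); rewrite divfK ?path_gain_neq0 //.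
apply: (@balanced_path_gain u (v :: walk v)) => //=.
  by rewrite Guv /=.
by rewrite !last_walk.
Qed.

(* Every entry of Dmax and Dmin is the distance times the gain of some
   shortest path; the argument uses no other property of the selection. *)
Definition geodesic_gain (g : 'I_n -> 'I_n -> R[i]) : Prop :=
  forall s t, exists2 p, p \in shortest_paths G s t & g s t = path_gain Phi s p.

Lemma opt_max_geodesic : connected G -> geodesic_gain (opt_max Phi).
Proof.
move=> [_ Gc] s t; have := shortest_paths_neq0 (connect_dist_lt (Gc s t)).
exact: (pick_lex_extremum ge_refl ge_trans ge_total).
Qed.

Lemma opt_min_geodesic : connected G -> geodesic_gain (opt_min Phi).
Proof.
move=> [_ Gc] s t; have := shortest_paths_neq0 (connect_dist_lt (Gc s t)).
exact: (pick_lex_extremum le_refl le_trans le_total).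
Qed.

Lemma geodesic_gain_herm (lt : rel 'I_n) g : geodesic_gain g ->
  geodesic_gain (fun s t => if lt t s then conjc (g t s) else g s t).
Proof.
move=> gP s t; case: ifP => _; last exact: gP.
have [p Gp ->] := gP t s.
exists (tcast (dist_sym G t s) (rev_tuple (belast_tuple t p))).
  exact: rev_shortest_path.
move: Gp; rewrite inE val_tcast => /and3P[Gp /eqP last_p _].
by rewrite conjc_path_gain // -path_gain_rev // last_p.
Qed.

Lemma geodesic_gain_norm g s t : geodesic_gain g -> `|g s t| = 1.
Proof.
by case/(_ s t) => p; rewrite inE => /andP[Gp _] ->; apply: path_gain_norm.
Qed.

Lemma geodesic_gain_adj g s t :
  geodesic_gain g -> G s t -> g s t = gain Phi s t.
Proof.
case/(_ s t) => p; rewrite inE => /and3P[_ last_p _] -> Gst.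
have : size p = 1%N by rewrite size_tuple dist_adj.
by case: (tval p) last_p => [|u []] //= /eqP-> _; rewrite mulr1.
Qed.

End GainTheory.

Section Switching.
Variable n : nat.

Lemma char_poly_similar (K : comUnitRingType) (P A B : 'M[K]_n) :
  P \in unitmx -> P *m A = B *m P -> char_poly A = char_poly B.
Proof.
move=> P_unit PA; pose Q := map_mx (@polyC K) P.
have detQK : \det (map_mx (@polyC K) (invmx P)) * \det Q = 1.
  by rewrite -det_mulmx -map_mxM mulVmx // map_mx1 det1.
rewrite -[LHS]mul1r -[RHS]mul1r -detQK -!mulrA; congr (_ * _).
rewrite -det_mulmx [RHS]mulrC -det_mulmx; congr (\det _).
by rewrite /char_poly_mx mulmxBl mulmxBr -!map_mxM PA scalar_mxC.
Qed.

Definition switching (K : unitRingType) (theta : 'I_n -> K) (A : 'M[K]_n) :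
  'M[K]_n := \matrix_(i, j) (theta i * A i j / theta j).

Lemma char_poly_switching (K : fieldType) (theta : 'I_n -> K) (A : 'M[K]_n) :
  (forall i, theta i != 0) -> char_poly (switching theta A) = char_poly A.
Proof.
move=> theta_neq0; pose T := diag_mx (\row_i theta i).
have T_unit : T \in unitmx.
  rewrite unitmxE det_diag unitfE; apply/prodf_neq0 => i _.
  by rewrite mxE.
apply/esym/(char_poly_similar T_unit)/matrixP => i j.
by rewrite mul_mx_diag mul_diag_mx !mxE divfK.
Qed.

End Switching.

Section NormalSpectrum.
Variables (C : numClosedFieldType) (n : nat).
Implicit Types (D P : 'M[C]_n) (y d : 'rV[C]_n).
Local Open Scope sesquilinear_scope.

Lemma eigenvalue_normalP D a : D \is normalmx ->
  reflect (exists k, a = spectral_diag D 0 k) (eigenvalue D a).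
Proof.
move=> /orthomx_spectralP defD; set d := spectral_diag D in defD *.
have similarD : spectralmx D *m D = diag_mx d *m spectralmx D.
  by rewrite {2}defD !mulmxA mulmxV ?spectral_unit // mul1mx.
rewrite eigenvalue_root_char (char_poly_similar (spectral_unit D) similarD).
rewrite char_poly_trig ?diag_mx_is_trig //.
rewrite -(big_map _ predT (fun b => 'X - b%:P)) root_prod_XsubC.
by apply: (iffP mapP) => [[k _ ->]|[k ->]];
  exists k; rewrite ?mem_index_enum // mxE eqxx.
Qed.

Lemma unitary_diag_form P d y : P \is unitarymx ->
  (y *m (invmx P *m diag_mx d *m P) *m y^t*) 0 0 =
  \sum_k d 0 k * `|(y *m invmx P) 0 k| ^+ 2.
Proof.
move=> P_unitary; set w := y *m invmx P.
have -> : y *m (invmx P *m diag_mx d *m P) *m y^t* = w *m diag_mx d *m w^t*.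
  by rewrite /w trmx_mul map_mxM invmx_unitary // trmxCK !mulmxA.
rewrite mul_mx_diag !mxE; apply: eq_bigr => k _; rewrite !mxE normCK.
by rewrite mulrAC mulrC.
Qed.

(* [l%:M - D] is positive semidefinite, so its quadratic form vanishes only on
   its kernel. *)
Lemma rayleigh_max_eigenvector D (l : C) y :
    D \is normalmx -> (forall a, eigenvalue D a -> a <= l) ->
    l * (y *m y^t*) 0 0 <= (y *m D *m y^t*) 0 0 ->
  y *m D = l *: y.
Proof.
move=> D_normal le_l le_form; have defD := orthomx_spectralP D_normal.
have P_unit := spectral_unit D; set P := spectralmx D in defD P_unit.
pose d := const_mx l - spectral_diag D.
have gapE : l%:M - D = invmx P *m diag_mx d *m P.
  rewrite raddfB /= diag_const_mx mulmxBr mulmxBl -defD.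
  by rewrite mul_mx_scalar -scalemxAl mulVmx // scalemx1.
have d_ge0 k : 0 <= d 0 k.
  by rewrite !mxE subr_ge0; apply/le_l/eigenvalue_normalP => //; exists k.
have term_ge0 k : true -> 0 <= d 0 k * `|(y *m invmx P) 0 k| ^+ 2.
  by rewrite mulr_ge0 ?exprn_ge0.
have form_eq0 : \sum_k d 0 k * `|(y *m invmx P) 0 k| ^+ 2 = 0.
  apply/le_anti; rewrite sumr_ge0 // andbT -unitary_diag_form; last first.
    exact: spectral_unitarymx.
  rewrite -gapE mulmxBr mulmxBl mul_mx_scalar -scalemxAl.
  by rewrite mxE [X in X + _]mxE [X in _ + X]mxE subr_le0.
apply/esym/eqP; rewrite -subr_eq0 -mul_mx_scalar -mulmxBr gapE !mulmxA.
suff -> : y *m invmx P *m diag_mx d = 0 by rewrite mul0mx.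
rewrite mul_mx_diag; apply/rowP => k; rewrite [LHS]mxE [RHS]mxE.
have /eqP := psumr_eq0P term_ge0 form_eq0 (i := k) isT.
rewrite mulf_eq0 sqrf_eq0 normr_eq0 mulrC => /orP[]/eqP ->.
  by rewrite mul0r.
by rewrite mulr0.
Qed.

End NormalSpectrum.

Lemma normC_sum_eq_phase (C : numClosedFieldType) (I : finType) (P : pred I)
    (F : I -> C) :
    `|\sum_(i | P i) F i| = \sum_(i | P i) `|F i| ->
  forall i, P i -> F i * `|\sum_(i | P i) F i| = `|F i| * \sum_(i | P i) F i.
Proof.
move=> normF; have [u _ F_dir] := normC_sum_eq normF => i Pi.
rewrite normF [in RHS](eq_bigr _ F_dir) -mulr_suml [in LHS]F_dir //.
by rewrite -mulrA [u * _]mulrC.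
Qed.

Section WielandtEquality.
Variable n : nat.

Definition absmx (K : numDomainType) m (A : 'M[K]_(m, n)) : 'M[K]_(m, n) :=
  map_mx Num.norm A.

Lemma ge0_eigenvector_neq0 (K : numDomainType) (D : 'M[K]_n) (y : 'rV_n)
    (l : K) :
    (forall i j, 0 <= D i j) -> (forall i j, i != j -> D i j != 0) ->
    (forall i, 0 <= y 0 i) -> y *m D = l *: y -> y != 0 ->
  forall j, y 0 j != 0.
Proof.
move=> D_ge0 D_neq0 y_ge0 yD y_neq0 j; apply: contraNneq y_neq0 => yj0.
apply/eqP/rowP => i; rewrite mxE; have [->//|neq_ij] := eqVneq i j.
have term_ge0 k : true -> 0 <= y 0 k * D k j by rewrite mulr_ge0.
have sum_eq0 : \sum_k y 0 k * D k j = 0.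
  by move/rowP: yD => /(_ j); rewrite !mxE yj0 mulr0.
have /eqP := psumr_eq0P term_ge0 sum_eq0 (i := i) isT.
by rewrite mulf_eq0 (negbTE (D_neq0 _ _ neq_ij)) orbF => /eqP.
Qed.

Variable C : numClosedFieldType.
Implicit Types (A : 'M[C]_n) (x : 'rV[C]_n).

Lemma absmx_eigenvector A x (l : C) :
    absmx A \is normalmx -> l \is Num.real ->
    (forall a, eigenvalue (absmx A) a -> a <= l) ->
    x *m A = l *: x ->
  absmx x *m absmx A = l *: absmx x.
Proof.
move=> absA_normal l_real le_l xA.
apply: rayleigh_max_eigenvector => //.
rewrite !mxE mulr_sumr; apply: ler_sum => j _; rewrite !mxE mulrA.
rewrite ler_wpM2r ?conjC_ge0 //.
apply: le_trans (_ : `|l * x 0 j| <= _).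
  by rewrite normrM ler_wpM2r // real_ler_norm.
have <- : \sum_i x 0 i * A i j = l * x 0 j.
  by move/rowP: xA => /(_ j); rewrite !mxE.
apply: le_trans (ler_norm_sum _ _ _) _.
by apply: ler_sum => i _; rewrite !mxE normrM.
Qed.

Lemma absmx_eigenvector_switching A x (l : C) :
    (forall i, x 0 i != 0) ->
    x *m A = l *: x -> absmx x *m absmx A = l *: absmx x ->
  A = switching (fun i => `|x 0 i| / x 0 i) (absmx A).
Proof.
move=> x_neq0 xA abs_xA; apply/matrixP => i j; rewrite !mxE.
have sumE : \sum_k x 0 k * A k j = l * x 0 j.
  by move/rowP: xA => /(_ j); rewrite !mxE.
have sum_normE : \sum_k `|x 0 k * A k j| = l * `|x 0 j|.
  move/rowP: abs_xA => /(_ j); rewrite !mxE => <-.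
  by apply: eq_bigr => k _; rewrite !mxE normrM.
have l_ge0 : 0 <= l.
  by rewrite -(@pmulr_lge0 _ `|x 0 j|) ?normr_gt0 // -sum_normE sumr_ge0.
have [l0|l_neq0] := eqVneq l 0.
  move: sum_normE; rewrite l0 mul0r => sum_eq0.
  have /eqP := psumr_eq0P (fun k _ => normr_ge0 _) sum_eq0 (i := i) isT.
  rewrite normr_eq0 mulf_eq0 (negbTE (x_neq0 i)) => /eqP ->.
  by rewrite normr0 mulr0 mul0r.
have norm_sum : `|\sum_k x 0 k * A k j| = \sum_k `|x 0 k * A k j|.
  by rewrite sum_normE sumE normrM ger0_norm.
have := normC_sum_eq_phase norm_sum (i := i) isT.
rewrite sumE !normrM (ger0_norm l_ge0) => phase.
have norm_x_neq0 k : `|x 0 k| != 0 by rewrite normr_eq0.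
apply: (mulIf (mulf_neq0 (x_neq0 i) (mulf_neq0 l_neq0 (norm_x_neq0 j)))).
transitivity (`|x 0 i| * `|A i j| * (l * x 0 j)); first by rewrite -phase; ring.
by field; rewrite norm_x_neq0 !x_neq0.
Qed.

Lemma wielandt_equality A (l : C) :
    absmx A \is normalmx -> (forall i j, i != j -> A i j != 0) ->
    l \is Num.real ->
    (forall a, eigenvalue (absmx A) a -> a <= l) -> eigenvalue A l ->
  exists2 theta : 'I_n -> C, forall i, theta i != 0 &
    A = switching theta (absmx A).
Proof.
move=> absA_normal A_neq0 l_real le_l /eigenvalueP[x xA x_neq0].
have abs_xA := absmx_eigenvector absA_normal l_real le_l xA.
have entry_neq0 i : x 0 i != 0.
  have abs_x_neq0 : absmx x != 0.
    apply: contraNneq x_neq0 => /rowP abs_x0; apply/eqP/rowP => k.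
    by have := abs_x0 k; rewrite !mxE => /normr0_eq0.
  suff: absmx x 0 i != 0 by rewrite mxE normr_eq0.
  apply: (ge0_eigenvector_neq0 _ _ _ abs_xA abs_x_neq0) => [j k|j k neq_jk|k].
  - by rewrite mxE.
  - by rewrite mxE normr_eq0 A_neq0.
  - by rewrite mxE.
exists (fun i => `|x 0 i| / x 0 i) => [i|].
  by rewrite mulf_neq0 ?invr_eq0 ?normr_eq0.
exact: absmx_eigenvector_switching abs_xA.
Qed.

End WielandtEquality.

Section LargestEigenvalue.
Variables (R : realType) (n : nat).
Implicit Types A B : 'M[R[i]]_n.

Lemma mem_spectrum A a : (a \in spectrum A) = eigenvalue A a.
Proof.
rewrite eigenvalue_root_char /spectrum.
case: closed_field_poly_normal => /= r ->.
by rewrite (monicP (char_poly_monic A)) scale1r root_prod_XsubC.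
Qed.

Lemma hermitian_largest_eigenvalue A :
  (0 < n)%N -> A \is hermsymmx -> exists l, largest_eigenvalue A l.
Proof.
move=> n_gt0 A_herm; have A_normal := hermitian_normalmx A_herm.
have /mxOverP d_real := hermitian_spectral_diag_real A_herm.
pose re k := complex.Re (spectral_diag A 0 k).
have [k _ max_k] := @arg_maxP _ _ _ (Ordinal n_gt0) xpredT re isT.
exists (re k); split.
  by apply/eigenvalue_normalP => //; exists k; rewrite RRe_real.
move=> _ /(eigenvalue_normalP _ A_normal)[j ->].
by rewrite -(RRe_real (d_real 0 j)) lecR; apply: max_k.
Qed.

Lemma same_spectrum_largest_eigenvalue A B :
    (0 < n)%N -> B \is hermsymmx -> same_spectrum A B ->
  same_largest_eigenvalue A B.
Proof.
move=> n_gt0 B_herm /perm_mem same_mem.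
have same_eigen a : eigenvalue A a = eigenvalue B a.
  by rewrite -mem_spectrum same_mem mem_spectrum.
have [l [Bl max_l]] := hermitian_largest_eigenvalue n_gt0 B_herm.
by exists l; split; split=> [|x]; rewrite ?same_eigen //; apply: max_l.
Qed.

Lemma distmx_hermitian (G : sgraph n) : distmx R G \is hermsymmx.
Proof.
apply/is_hermitianmxP; rewrite expr0 scale1r.
by apply/matrixP => s t; rewrite !mxE conjC_nat dist_sym.
Qed.

End LargestEigenvalue.

Section GainDistanceMatrix.
Variables (R : realType) (n : nat) (Phi : gain_graph R n).
Local Notation G := (ugraph Phi).
Implicit Types (g : 'I_n -> 'I_n -> R[i]) (theta : 'I_n -> R[i]).

Definition gain_distmx g : 'M[R[i]]_n :=
  \matrix_(s, t) (g s t * (dist G s t)%:R).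

Variable g : 'I_n -> 'I_n -> R[i].
Hypothesis gP : geodesic_gain Phi g.

Lemma absmx_gain_distmx : absmx (gain_distmx g) = distmx R G.
Proof.
apply/matrixP => s t; rewrite !mxE normrM normr_nat.
by rewrite (geodesic_gain_norm s t gP) mul1r.
Qed.

Lemma potential_gain_distmx theta :
  potential Phi theta -> gain_distmx g = switching theta (distmx R G).
Proof.
move=> thetaP; apply/matrixP => s t; rewrite !mxE; have [p + ->] := gP s t.
rewrite inE => /and3P[Gp /eqP last_p _].
by rewrite (potential_path_gain thetaP Gp) last_p mulrAC.
Qed.

Lemma switching_gain_distmx_potential theta :
    (forall v, theta v != 0) ->
    gain_distmx g = switching theta (distmx R G) ->
  potential Phi theta.
Proof.
move=> theta_neq0 /matrixP switchE; split=> // u v Guv; have := switchE u v.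
by rewrite !mxE dist_adj // !mulr1 (geodesic_gain_adj gP Guv).
Qed.

Hypothesis Gc : connected G.

Lemma balanced_same_spectrum :
  balanced Phi -> same_spectrum (gain_distmx g) (distmx R G).
Proof.
case/(balanced_potential Gc) => theta thetaP; have [theta_neq0 _] := thetaP.
rewrite /same_spectrum /spectrum (potential_gain_distmx thetaP).
by rewrite char_poly_switching.
Qed.

Lemma same_largest_eigenvalue_balanced :
  same_largest_eigenvalue (gain_distmx g) (distmx R G) -> balanced Phi.
Proof.
case=> l [[gain_l _] [_]]; rewrite -absmx_gain_distmx => max_l.
have absA_normal : absmx (gain_distmx g) \is normalmx.
  by rewrite absmx_gain_distmx; apply/hermitian_normalmx/distmx_hermitian.
have A_neq0 s t : s != t -> gain_distmx g s t != 0.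
  move=> neq_st; rewrite mxE mulf_neq0 //.
    by rewrite -normr_eq0 (geodesic_gain_norm s t gP) oner_neq0.
  by rewrite pnatr_eq0 -lt0n dist_gt0.
have l_real : real_complex R l \is Num.real by apply/complex_realP; exists l.
have [theta theta_neq0] :=
  wielandt_equality absA_normal A_neq0 l_real max_l gain_l.
rewrite absmx_gain_distmx => /(switching_gain_distmx_potential theta_neq0).
exact: potential_balanced.
Qed.

Lemma balanced_iff_same_largest_eigenvalue :
  balanced Phi <-> same_largest_eigenvalue (gain_distmx g) (distmx R G).
Proof.
split; last exact: same_largest_eigenvalue_balanced.
move/balanced_same_spectrum.
exact: same_spectrum_largest_eigenvalue Gc.1 (distmx_hermitian R G).
Qed.

Lemma balanced_iff_same_spectrum :
  balanced Phi <-> same_spectrum (gain_distmx g) (distmx R G).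
Proof.
split; first exact: balanced_same_spectrum.
move/(same_spectrum_largest_eigenvalue Gc.1 (distmx_hermitian R G)).
exact: same_largest_eigenvalue_balanced.
Qed.

End GainDistanceMatrix.

Theorem theorem5p4 (R : realType) (n : nat) (Phi : gain_graph R n)
    (lt : rel 'I_n) (hG : connected (ugraph Phi))
    (hlt : strict_total_order lt) :
  [<-> balanced Phi;
       same_spectrum (Dmax Phi lt) (distmx R (ugraph Phi));
       same_spectrum (Dmin Phi lt) (distmx R (ugraph Phi));
       same_largest_eigenvalue (Dmax Phi lt) (distmx R (ugraph Phi));
       same_largest_eigenvalue (Dmin Phi lt) (distmx R (ugraph Phi))].
Proof.
set D := distmx R _.
have max_geo : geodesic_gain Phi (gain_max Phi lt).
  exact/geodesic_gain_herm/opt_max_geodesic.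
have min_geo : geodesic_gain Phi (gain_min Phi lt).
  exact/geodesic_gain_herm/opt_min_geodesic.
have max_spec : balanced Phi <-> same_spectrum (Dmax Phi lt) D.
  exact: balanced_iff_same_spectrum.
have min_spec : balanced Phi <-> same_spectrum (Dmin Phi lt) D.
  exact: balanced_iff_same_spectrum.
have max_eigen : balanced Phi <-> same_largest_eigenvalue (Dmax Phi lt) D.
  exact: balanced_iff_same_largest_eigenvalue.
have min_eigen : balanced Phi <-> same_largest_eigenvalue (Dmin Phi lt) D.
  exact: balanced_iff_same_largest_eigenvalue.
by tfae; [move/max_spec | move/max_spec/min_spec | move/min_spec/max_eigen
  | move/max_eigen/min_eigen | move/min_eigen].
Qed.
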